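(* Let $q$ be a prime power and $n\in\mathbb{N}$. There exists a symmetric Jordan basis $J(q,n)$ of $V(B_q(n))$ such that: (i) the elements of $J(q,n)$ are pairwise orthogonal with respect to the standard inner product $\langle\,,\rangle$ on $V(B_q(n))$; (ii) (singular values) for every $0\le k\le n/2$ and every symmetric Jordan chain $(v_k,\ldots,v_{n-k})$ in $J(q,n)$ starting at rank $k$ and ending at rank $n-k$, we have, for $k\le u<n-k$, $$\frac{\|v_{u+1}\|}{\|v_u\|}=\sqrt{q^k\,[u+1-k]_q\,[n-k-u]_q}.$$
   Context: For $k\in\mathbb{N}$, $[k]_q=1+q+\cdots+q^{k-1}$ (so $[0]_q=0$). $B_q(n)$ is the set of all subspaces of an $n$-dimensional vector space over $\mathbb{F}_q$, partially ordered by inclusion; it is a graded poset of rank $n$ with the rank of a subspace given by its dimension. $B_q(n)_i$ denotes the set of $i$-dimensional subspaces. For a finite set $S$, $V(S)$ is the complex vector space with $S$ as basis. Thus $V(B_q(n))=\bigoplus_{i=0}^n V(B_q(n)_i)$. An element $v\in V(B_q(n))$ is homogeneous if $v\in V(B_q(n)_i)$ for some $i$; if also $v\neq 0$, its rank is $r(v)=i$. The up operator $U:V(B_q(n))\to V(B_q(n))$ is the linear map with $U(X)=\sum_{Y}Y$, the sum over all $Y\in B_q(n)$ covering $X$ (i.e. $X\subseteq Y$, $\dim Y=\dim X+1$). A symmetric Jordan chain is a sequence $(v_k,\ldots,v_{n-k})$, $k\le n/2$, of nonzero homogeneous elements of $V(B_q(n))$ such that $r(v_i)=i$ for $i=k,\ldots,n-k$,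 $U(v_{i-1})=v_i$ for $i=k+1,\ldots,n-k$, and $U(v_{n-k})=0$; it is said to start at rank $k$ and end at rank $n-k$. A symmetric Jordan basis of $V(B_q(n))$ is a basis of $V(B_q(n))$ consisting of a disjoint union of symmetric Jordan chains. The standard inner product on $V(B_q(n))$ is the one for which $\langle X,Y\rangle=\delta(X,Y)$ (Kronecker delta) for $X,Y\in B_q(n)$, and $\|v\|=\sqrt{\langle v,v\rangle}$. *)

(* Defs.v *)
From HB Require Import structures.
From mathcomp Require Import all_boot all_order all_algebra.
From mathcomp Require Import complex reals.

Set Implicit Arguments.
Unset Strict Implicit.
Unset Printing Implicit Defensive.

Import Order.TTheory GRing.Theory Num.Theory.
Import VectorInternalTheory.
Local Open Scope ring_scope.

HB.instance Definition _ (F : finFieldType) (E : vectType F) :=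
  [Countable of {vspace E} by <:].
HB.instance Definition _ (F : finFieldType) (E : vectType F) :=
  [Finite of {vspace E} by <:].

Definition qint (q k : nat) : nat := (\sum_(i < k) q ^ i)%N.

Notation freeVect C S := {ffun S -> C^o}.

Section SymmetricJordan.

Variables (C : numClosedFieldType) (F : finFieldType) (E : vectType F).

Local Notation n := (\dim {:E}).
Local Notation V := (freeVect C {vspace E}).

Implicit Types (X Y : {vspace E}) (v w : V) (s J : seq V).

Definition single X : V := [ffun Y => (Y == X)%:R].

Definition covers X Y : bool := (X <= Y)%VS && (\dim Y == (\dim X).+1).

(* The linear extension of [X |-> \sum_(Y covering X) Y]; see [up_single]. *)
Definition up v : V := \sum_X v X *: \sum_(Y | covers X Y) single Y.

Lemma up_is_linear : linear up.
Proof.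
move=> a v w; rewrite /up scaler_sumr -big_split; apply: eq_bigr => X _ /=.
by rewrite !ffunE scalerDl scalerA.
Qed.

HB.instance Definition _ := GRing.isLinear.Build C V V _ up up_is_linear.

Lemma up_single X : up (single X) = \sum_(Y | covers X Y) single Y.
Proof.
rewrite /up (bigD1 X) //= ffunE eqxx scale1r -[RHS]addr0; congr (_ + _).
by apply: big1 => Y nYX; rewrite ffunE (negbTE nYX) scale0r.
Qed.

Definition homogeneous (i : nat) v : Prop := forall X, v X != 0 -> \dim X = i.

Definition inner v w : C := \sum_X (v X : C) * (w X : C)^*.

Definition vnorm v : C := sqrtC (inner v v).

(* The chain (v_k, ..., v_(n-k)) is the sequence [s] with v_i = s`_(i - k). *)
Definition sym_jordan_chain (k : nat) s : Prop :=
  [/\ (k.*2 <= n)%N,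
      size s = (n - k.*2).+1,
      forall i, (k <= i <= n - k)%N ->
        s`_(i - k) != 0 /\ homogeneous i s`_(i - k),
      forall i, (k < i <= n - k)%N -> up s`_(i.-1 - k) = s`_(i - k)
    & up s`_(n - k - k) = 0].

(* Disjointness of the chains is implied: a basis has no repeated entry. *)
Definition sym_jordan_basis J : Prop :=
  basis_of {:V} J /\
  exists2 cs : seq (seq V),
    forall s, s \in cs -> exists k, sym_jordan_chain k s
    & perm_eq (flatten cs) J.

End SymmetricJordan.

(* Main.v *)
Require Import Defs.
From HB Require Import structures.
From mathcomp Require Import all_boot all_order all_algebra.
From mathcomp Require Import complex reals.
From mathcomp Require Import finfield zify ring.

Set Implicit Arguments.
Unset Strict Implicit.
Unset Printing Implicit Defensive.

Import Order.TTheory GRing.Theory Num.Theory.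
Local Open Scope ring_scope.

(** Let U be the up operator, D its adjoint, and n the dimension of E.  Both
    DU and UD send a subspace X to a combination of subspaces Z of the same
    dimension, and for Z != X they give it the same coefficient: X and Z have
    a common upper cover exactly when they have a common lower cover, and
    then X + Z and X :&: Z are the only ones ([card_common_covers]).  The
    diagonal coefficients count the upper and the lower covers of X, so that
      DU - UD = [n-k]_q - [k]_q   on rank k   ([down_up]).

    Call a vector of rank k primitive if D kills it.  Moving D through
    U^(j+1) v for a primitive v of rank k sums these commutators to
      D U^(j+1) v = q^k [j+1]_q [n-2k-j]_q U^j v   ([down_iter_up]).
    Since D is the adjoint of U, this number is the square of the ratio of the
    norms of U^(j+1) v and U^j v.  It is positive for j < n - 2k and zero for
    j = n - 2k, so v starts a symmetric Jordan chain with the required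
    singular values, and two such chains from orthogonal primitive vectors
    are orthogonal ([inner_primitives]).  No nonzero primitive vector has
    rank k > n/2, since the commutator is negative there ([primitive_high]).

    The basis J collects the chains that start at orthogonal bases of the
    spaces of primitive vectors of rank k <= n/2.  It spans: the span of J is
    stable under U, hence its orthogonal complement is stable under D, and by
    induction on the rank a homogeneous vector v of that complement satisfies
    D v = 0; so v is primitive, lies in the span of J as well, and vanishes
    ([orthogonal_jordan_basis_eq0]).

    Finally, a symmetric Jordan chain whose vectors all belong to J need not
    be given as one of the chains used to build J.  Its first vector is some
    U^j b with b primitive, and if j > 0 then U would not kill the last
    vector, because the chain of b extends to a higher rank
    ([sym_jordan_chain_start]); so it is primitive after all.  *)

(** * q-integers *)

Section QInt.

Variable q : nat.

Lemma qint0 : qint q 0 = 0%N.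
Proof. by rewrite /qint big_ord0. Qed.

Lemma qintD a b : (qint q (a + b) = qint q a + q ^ a * qint q b)%N.
Proof.
rewrite /qint big_split_ord /= big_distrr /=; congr addn.
by apply: eq_bigr => i _; rewrite expnD.
Qed.

Lemma qint1 : qint q 1 = 1%N.
Proof. by rewrite /qint big_ord1. Qed.

Lemma qintS a : qint q a.+1 = (1 + q * qint q a)%N.
Proof. by rewrite -add1n qintD qint1 expn1. Qed.

Lemma qint_gt0 a : (0 < a)%N -> (0 < qint q a)%N.
Proof. by case: a => // a _; rewrite qintS. Qed.

Lemma qint_mul_pred a : ((q - 1) * qint q a = q ^ a - 1)%N.
Proof. by rewrite !subn1 -predn_exp. Qed.

Lemma ltn_qint a b : (0 < q)%N -> (a < b)%N -> (qint q a < qint q b)%N.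
Proof.
move=> q0 ab; rewrite -(subnKC (ltnW ab)) qintD -[ltnLHS]addn0 ltn_add2l.
by rewrite muln_gt0 expn_gt0 q0 qint_gt0 // subn_gt0.
Qed.

(** One commutation step for the eigenvalues of DU along a chain: with
    m = n - 2k - j, the eigenvalue at step j - 1 plus [n-k-j]_q is the
    eigenvalue at step j plus [k+j]_q. *)
Lemma qint_step k j m :
  (q ^ k * qint q j * qint q m.+1 + qint q (m + k) =
   q ^ k * qint q j.+1 * qint q m + qint q (k + j))%N.
Proof. by rewrite addnC (addnC m) !qintD !qintS; ring. Qed.

End QInt.

(** * Counting covers in the subspace lattice *)

Section Counting.

Variables (F : finFieldType) (E : vectType F).
Local Notation q := #|F|.
Implicit Types W X Y A : {vspace E}.

Lemma dimv_add_line X (y : E) : y \notin X -> \dim (X + <[y]>) = (\dim X).+1.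
Proof.
move=> yX; apply/eqP; rewrite eqn_leq; apply/andP; split.
  apply: leq_trans (dimv_add_leqif _ _) _; rewrite -addn1 leq_add2l.
  by rewrite dim_vline leq_b1.
rewrite ltnNge; apply: contra yX => le.
have /eqP -> : (X == X + <[y]>)%VS by rewrite eqEdim addvSl.
by rewrite (subvP (addvSr _ _)) ?memv_line.
Qed.

(** [finvect_type E] is E seen as a finite type; the count goes through
    coordinates in a basis of X. *)
Lemma card_mem_vspace X :
  #|[set y : finvect_type E | y \in X]| = (q ^ \dim X)%N.
Proof.
pose f (c : {ffun 'I_(\dim X) -> F}) : finvect_type E :=
  \sum_i c i *: (vbasis X)`_i.
have f_inj : injective f.
  move=> c d cd; apply/ffunP=> i.
  have free_X := basis_free (vbasisP X).
  rewrite -(coord_sum_free c i free_X) -(coord_sum_free d i free_X).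
  by congr (coord _ i _).
rewrite -[X in (_ ^ X)%N]card_ord -card_ffun -(card_imset _ f_inj).
apply: eq_card => y; rewrite !inE; apply/idP/imsetP=> [yX|[c _ ->]].
  exists [ffun i => coord (vbasis X) i (y : E)] => //.
  rewrite [LHS](coord_vbasis yX); apply: eq_bigr => i _.
  by rewrite ffunE.
apply: (@rpred_sum E) => i _; rewrite rpredZ ?vbasis_mem //.
by rewrite mem_nth ?size_tuple.
Qed.

Lemma card_vspaceD W X : (W <= X)%VS ->
  #|[set y : finvect_type E | (y \in X) && (y \notin W)]| =
    (q ^ \dim X - q ^ \dim W)%N.
Proof.
move=> sWX; rewrite -!card_mem_vspace.
rewrite -(setIidPr (_ : [set y : finvect_type E | y \in W]
                       \subset [set y : finvect_type E | y \in X])).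
  by rewrite -cardsD; apply: eq_card => y; rewrite !inE andbC.
by apply/subsetP=> y; rewrite !inE; exact: (subvP sWX).
Qed.

(** Every vector y of X outside W spans with W a cover of W below X, and each
    cover arises from q^(dim W + 1) - q^(dim W) of them. *)
Lemma card_covers_in W X : (W <= X)%VS ->
  #|[set A | covers W A && (A <= X)%VS]| = qint q (\dim X - \dim W).
Proof.
move=> sWX; have q1 : (1 < q)%N := card_finNzRing_gt1 F.
set C := [set A | _].
have : (#|C| * (q ^ (\dim W).+1 - q ^ \dim W) = q ^ \dim X - q ^ \dim W)%N.
  rewrite -card_vspaceD // -[RHS]sum1_card.
  pose f (y : finvect_type E) : {vspace E} := (W + <[y : E]>)%VS.
  rewrite (partition_big f (mem C)) /=; last first.
    move=> y; rewrite !inE => /andP[yX yW]; rewrite /covers addvSl.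
    by rewrite dimv_add_line // eqxx subv_add sWX -memvE.
  rewrite -sum_nat_const; apply: eq_bigr => A.
  rewrite inE => /andP[/andP[sWA /eqP dA] sAX].
  rewrite -dA -card_vspaceD // -sum1_card; apply: eq_bigl => y.
  rewrite !inE; apply/andP/andP=> [[yA yW]|[/andP[yX yW] /eqP <-]].
    rewrite (subvP sAX) // yW eqEdim subv_add sWA -memvE yA.
    by split; rewrite // /f dimv_add_line // dA leqnn.
  by split=> //; apply: (subvP (addvSr W <[y : E]>)); apply: memv_line.
have -> : (q ^ (\dim W).+1 - q ^ \dim W = q ^ \dim W * (q - 1))%N.
  by rewrite expnS mulnBr muln1 mulnC.
rewrite -{1}(subnKC (dimvS sWX)) expnD -{3}[(q ^ \dim W)%N]muln1 -mulnBr.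
rewrite -qint_mul_pred mulnCA => /eqP; rewrite eqn_pmul2l ?expn_gt0 ?(ltnW q1) //.
by rewrite mulnC eqn_pmul2l ?subn_gt0 // => /eqP.
Qed.

(** Induction on the codimension d of W in X, without passing to the dual
    space.  Count the pairs (A, Y) where A covers W, X covers Y and A <= Y:
    every Y lies above [d-1]_q such A by [card_covers_in], and every A lies
    below [d-1]_q such Y by induction, so there are as many Y as A.  Codimension
    1 is separate, since the factor [d-1]_q that is cancelled is 0 there. *)
Lemma card_cocovers_in W X : (W <= X)%VS ->
  #|[set Y | covers Y X && (W <= Y)%VS]| = qint q (\dim X - \dim W).
Proof.
move dE: (\dim X - \dim W)%N => d.
elim: d W dE => [|[|d] IH] W dE sWX; have dWX := dimvS sWX.
- rewrite qint0; apply/eqP; rewrite cards_eq0 -subset0; apply/subsetP=> Y.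
  rewrite !inE => /andP[/andP[_ /eqP dX] /dimvS dWY]; lia.
- rewrite qint1 -(cards1 W); apply: eq_card => Y; rewrite !inE.
  apply/andP/eqP=> [[/andP[_ /eqP dX] sWY]|->].
    by apply/eqP; rewrite eq_sym eqEdim sWY /=; lia.
  by rewrite /covers sWX subvv; split=> //=; lia.
set H := [set Y | _]; pose C := [set A | covers W A && (A <= X)%VS].
have e : (#|H| * qint q d.+1 = #|C| * qint q d.+1)%N.
  rewrite -!sum_nat_const.
  transitivity (\sum_(Y in H) \sum_(A | covers W A && (A <= Y)%VS) 1)%N.
    apply: eq_bigr => Y; rewrite inE => /andP[/andP[_ /eqP dX] sWY].
    rewrite sum1dep_card card_covers_in //; congr qint; lia.
  rewrite (exchange_big_dep (mem C)) /=; last first.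
    move=> Y A; rewrite !inE => /andP[/andP[sYX _] _] /andP[-> sAY].
    exact: subv_trans sAY sYX.
  apply: eq_bigr => A; rewrite inE => /andP[cA sAX].
  have [sWA /eqP dA] := andP cA.
  rewrite -(IH A) ?sum1dep_card //; last lia.
  apply: eq_card => Y; rewrite !inE cA /=.
  case: (boolP (A <= Y)%VS) => [sAY|]; rewrite ?andbF // !andbT.
  by rewrite (subv_trans sWA sAY) andbT.
move/eqP: e; rewrite eqn_pmul2r ?qint_gt0 // => /eqP ->.
by rewrite card_covers_in ?dE.
Qed.

Lemma card_covers X :
  #|[set Y | covers X Y]| = qint q (\dim {:E} - \dim X).
Proof.
rewrite -card_covers_in ?subvf //; apply: eq_card => Y.
by rewrite !inE subvf andbT.
Qed.

Lemma card_cocovers X : #|[set Y | covers Y X]| = qint q (\dim X).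
Proof.
rewrite -[\dim X]subn0 -[X in (_ - X)%N](dimv0 E) -card_cocovers_in ?sub0v //.
by apply: eq_card => Y; rewrite !inE sub0v andbT.
Qed.

(** Both sets have at most one element, X + Z and X :&: Z respectively.  They
    are nonempty under the same condition because
    dim (X + Z) + dim (X :&: Z) = dim X + dim Z. *)
Lemma card_common_covers X Z : X != Z ->
  #|[set Y | covers X Y && covers Z Y]| =
  #|[set Y | covers Y X && covers Y Z]|.
Proof.
move=> XZ; have [dXZ|dXZ] := eqVneq (\dim X) (\dim Z); last first.
  by rewrite !eq_card0 // => Y; rewrite !inE /covers; apply/negP; lia.
have XnZ : ~~ (X <= Z)%VS by apply: contra XZ => s; rewrite eqEdim s dXZ /=.
have gtX : (\dim Z < \dim (X + Z))%N.
  rewrite ltnNge; apply: contra XnZ => le.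
  have /eqP -> : (Z == X + Z)%VS by rewrite eqEdim addvSr.
  exact: addvSl.
have ltX : (\dim (X :&: Z) < \dim X)%N.
  rewrite ltnNge; apply: contra XnZ => le.
  have /eqP <- : (X :&: Z == X)%VS by rewrite eqEdim capvSl.
  exact: capvSr.
have dd := dimv_sum_cap X Z.
have [e|ne] := eqVneq (\dim (X + Z)) (\dim X).+1.
  transitivity #|[set (X + Z)%VS]|; [|transitivity #|[set (X :&: Z)%VS]|].
  - apply: eq_card => Y; rewrite !inE /covers.
    apply/andP/eqP=> [[/andP[sX /eqP dY] /andP[sZ _]]|->].
      by apply/eqP; rewrite eq_sym eqEdim subv_add sX sZ /=; lia.
    by rewrite addvSl addvSr /=; lia.
  - by rewrite !cards1.
  - apply: eq_card => Y; rewrite !inE /covers.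
    apply/eqP/andP=> [->|[/andP[sX /eqP dY] /andP[sZ _]]].
      by rewrite capvSl capvSr /=; lia.
    by apply/eqP; rewrite eqEdim subv_cap sX sZ /=; lia.
rewrite !eq_card0 // => Y; rewrite !inE /covers; apply/negP.
  move=> /andP[/andP[sX /eqP dX] /andP[sZ /eqP dZ]].
  have /dimvS : (Y <= X :&: Z)%VS by rewrite subv_cap sX.
  move/eqP: ne; lia.
move=> /andP[/andP[sX /eqP dX] /andP[sZ /eqP dZ]].
have /dimvS : (X + Z <= Y)%VS by rewrite subv_add sX.
move/eqP: ne; lia.
Qed.

End Counting.

(** * Orthogonal families and Gram-Schmidt *)

Section Orthogonal.

Variables (C : numClosedFieldType) (F : finFieldType) (E : vectType F).
Local Notation V := (freeVect C {vspace E}).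
Implicit Types (v w x b : V) (B : seq V).

Lemma innerDl v w x : inner (v + w) x = inner v x + inner w x.
Proof. by rewrite -big_split; apply: eq_bigr => X _; rewrite ffunE mulrDl. Qed.

Lemma innerZl (a : C) v w : inner (a *: v) w = a * inner v w.
Proof. by rewrite [RHS]mulr_sumr; apply: eq_bigr => X _; rewrite ffunE mulrA. Qed.

Lemma inner_conj v w : (inner v w)^* = inner w v.
Proof.
by rewrite rmorph_sum; apply: eq_bigr => X _; rewrite rmorphM /= conjCK mulrC.
Qed.

Lemma inner0l v : inner 0 v = 0.
Proof. by rewrite -[X in inner X](scale0r 0) innerZl mul0r. Qed.

Lemma inner0r v : inner v 0 = 0.
Proof. by rewrite -inner_conj inner0l conjC0. Qed.

Lemma innerBl v w x : inner (v - w) x = inner v x - inner w x.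
Proof. by rewrite -scaleN1r innerDl innerZl mulN1r. Qed.

Lemma innerZr (a : C) v w : inner v (a *: w) = a^* * inner v w.
Proof. by rewrite -inner_conj innerZl rmorphM /= inner_conj. Qed.

Lemma inner_suml I (r : seq I) (P : pred I) (f : I -> V) w :
  inner (\sum_(i <- r | P i) f i) w = \sum_(i <- r | P i) inner (f i) w.
Proof.
exact: (big_morph (fun v => inner v w) (fun x y => innerDl x y w) (inner0l w)).
Qed.

Lemma inner_ge0 v : 0 <= inner v v.
Proof. by apply: sumr_ge0 => X _; apply: mul_conjC_ge0. Qed.

Lemma inner_eq0 v : (inner v v == 0) = (v == 0).
Proof.
apply/eqP/eqP=> [v0|->]; last exact: inner0l.
apply/ffunP=> X; rewrite ffunE; apply/eqP.
rewrite -(@mul_conjC_eq0 C); apply/eqP.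
by move/psumr_eq0P: v0 => -> // Y _; apply: mul_conjC_ge0.
Qed.

Lemma inner_span B v w :
  {in B, forall b, inner v b = 0} -> w \in <<B>>%VS -> inner v w = 0.
Proof.
move=> vB /(@coord_span _ _ _ (in_tuple B)) ->.
rewrite -inner_conj inner_suml big1 ?conjC0 // => i _.
by rewrite innerZl -inner_conj vB ?conjC0 ?mulr0 // mem_nth.
Qed.

Definition orthogonal_family B : Prop :=
  [/\ uniq B, 0 \notin B & {in B &, forall v w, v != w -> inner v w = 0}].

Lemma orthogonal_family_cons x B :
  x != 0 -> {in B, forall b, inner x b = 0} ->
  orthogonal_family B -> orthogonal_family (x :: B).
Proof.
move=> x0 xB [uB nB oB]; split.
- rewrite /= uB andbT; apply/negP=> /xB /eqP.
  by rewrite inner_eq0 (negbTE x0).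
- by rewrite inE negb_or eq_sym x0.
- move=> v w; rewrite !inE => /predU1P[->|vB] /predU1P[->|wB] vw.
  + by rewrite eqxx in vw.
  + exact: xB.
  + by rewrite -inner_conj xB // conjC0.
  + exact: oB.
Qed.

Lemma orthogonal_family_behead x B :
  orthogonal_family (x :: B) -> orthogonal_family B.
Proof.
case=> /= /andP[_ uB]; rewrite inE negb_or => /andP[_ nB] oB; split=> //.
by move=> v w vB wB; apply: oB; rewrite inE ?vB ?wB orbT.
Qed.

Lemma orthogonal_family_free B : orthogonal_family B -> free B.
Proof.
elim: B => [|x B IH] oB; first by rewrite nil_free.
rewrite free_cons IH ?andbT; last exact: orthogonal_family_behead oB.
case: oB => /= /andP[xB _]; rewrite inE negb_or eq_sym => /andP[x0 _] oB.
apply/negP=> sx; suff: inner x x = 0 by move/eqP; rewrite inner_eq0 (negbTE x0).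
apply: inner_span sx => b bB; apply: oB; rewrite ?inE ?eqxx ?bB ?orbT //.
by apply: contraNneq xB => ->.
Qed.

Definition residual B x : V :=
  x - \sum_(b <- B) (inner x b / inner b b) *: b.

Lemma residual_orthogonal B x :
  orthogonal_family B -> {in B, forall b, inner (residual B x) b = 0}.
Proof.
case=> uB nB oB b bB; rewrite innerBl inner_suml (bigD1_seq b) //= big1_seq.
  rewrite addr0 innerZl divfK ?subrr // inner_eq0.
  by apply: contraNneq nB => <-.
by move=> c /andP[cb cB]; rewrite innerZl (oB c b) // mulr0.
Qed.

Lemma mem_span_residual B x : (x - residual B x) \in <<B>>%VS.
Proof.
rewrite opprB addrC subrK big_seq; apply: rpred_sum => b bB.
by rewrite rpredZ // memv_span.
Qed.

(** The vectors are not normalized, and those that depend on the rest of X are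
    dropped, so that the result never contains 0. *)
Definition gram_schmidt (X : seq V) : seq V :=
  foldr (fun x B => let y := residual B x in if y == 0 then B else y :: B)
    [::] X.

Lemma gram_schmidt_orthogonal X : orthogonal_family (gram_schmidt X).
Proof.
elim: X => [|x X IH] /=; first by split.
case: ifP => // /negbT nz.
by apply: orthogonal_family_cons => //; apply: residual_orthogonal.
Qed.

Lemma span_gram_schmidt X : <<gram_schmidt X>>%VS = <<X>>%VS.
Proof.
elim: X => [|x X IH] //=; rewrite span_cons -IH.
set B := gram_schmidt X; have r := mem_span_residual B x.
case: eqP => [z|_].
  apply/esym/addv_idPr; rewrite -memvE; move: r; by rewrite z subr0.
rewrite span_cons; apply/eqP; rewrite eqEsubv !subv_add !addvSr -!memvE !andbT.
apply/andP; split.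
  rewrite -[residual B x](subKr x) memvB ?(subvP (addvSl _ _) _ (memv_line _)) //.
  exact: (subvP (addvSr _ _)).
rewrite -[x in x \in _](subrK (residual B x)) memvD //.
  exact: (subvP (addvSr _ _)).
exact: (subvP (addvSl _ _) _ (memv_line _)).
Qed.

End Orthogonal.

(** * The down operator and the commutation relation *)

Section UpDown.

Variables (C : numClosedFieldType) (F : finFieldType) (E : vectType F).
Local Notation q := #|F|.
Local Notation n := (\dim {:E}).
Local Notation V := (freeVect C {vspace E}).
Local Notation U := (@up C F E).
Implicit Types (X Y Z : {vspace E}) (v w x b : V).

Lemma upE v Y : up v Y = \sum_(X | covers X Y) v X.
Proof.
rewrite /up sum_ffunE [RHS]big_mkcond; apply: eq_bigr => X _.
rewrite ffunE sum_ffunE; case: ifP => cXY.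
  rewrite (bigD1 Y) //= big1 ?addr0.
    by rewrite ffunE eqxx; apply: mulr1.
  by move=> Z /andP[_ ZY]; rewrite ffunE eq_sym (negbTE ZY).
rewrite big1 ?scaler0 // => Z cXZ; rewrite ffunE.
by case: eqP cXZ => // <-; rewrite cXY.
Qed.

Definition down v : V := [ffun X => \sum_(Y | covers X Y) v Y].

Lemma down_is_linear : linear down.
Proof.
move=> a v w; apply/ffunP=> X; rewrite !ffunE scaler_sumr -big_split.
by apply: eq_bigr => Y _; rewrite !ffunE.
Qed.

HB.instance Definition _ := GRing.isLinear.Build C V V _ down down_is_linear.

Lemma inner_up v w : inner (up v) w = inner v (down w).
Proof.
rewrite /inner; under eq_bigr => Y _ do rewrite upE mulr_suml.
rewrite (exchange_big_dep xpredT) //=; apply: eq_bigr => X _.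
by rewrite ffunE rmorph_sum mulr_sumr.
Qed.

(** The coefficients of v Z in DU and in UD are the numbers of common upper and
    of common lower covers of X and Z. *)
Lemma down_up v X :
  down (up v) X = up (down v) X +
    ((qint q (n - \dim X))%:R - (qint q (\dim X))%:R) * (v X : C).
Proof.
have -> : down (up v) X =
    \sum_Z v Z *+ #|[set Y | covers X Y && covers Z Y]|.
  rewrite ffunE; under eq_bigr => Y _ do rewrite upE.
  rewrite (exchange_big_dep xpredT) //=; apply: eq_bigr => Z _.
  by rewrite sumr_const; congr (_ *+ _); apply: eq_card => Y; rewrite !inE.
have -> : up (down v) X =
    \sum_Z v Z *+ #|[set Y | covers Y X && covers Y Z]|.
  rewrite upE; under eq_bigr => Y _ do rewrite ffunE.
  rewrite (exchange_big_dep xpredT) //=; apply: eq_bigr => Z _.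
  by rewrite sumr_const; congr (_ *+ _); apply: eq_card => Y; rewrite !inE.
rewrite (bigD1 X) //= [in RHS](bigD1 X) //=.
under eq_bigr => Z ZX do rewrite card_common_covers 1?eq_sym //.
have -> : [set Y | covers X Y && covers X Y] = [set Y | covers X Y].
  by apply/setP=> Y; rewrite !inE andbb.
have -> : [set Y | covers Y X && covers Y X] = [set Y | covers Y X].
  by apply/setP=> Y; rewrite !inE andbb.
rewrite card_covers card_cocovers -[v X *+ _]mulr_natl.
rewrite -[v X *+ qint _ (\dim X)]mulr_natl.
by rewrite mulrBl [RHS]addrC addrA subrK.
Qed.

Lemma homogeneous_up k v : homogeneous k v -> homogeneous k.+1 (up v).
Proof.
move=> hv Y; rewrite upE => nz; apply/eqP; apply: contraNT nz => dY.
rewrite big1 // => X /andP[_ /eqP dX]; apply/eqP; apply: contraNT dY => /hv <-.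
exact/eqP.
Qed.

Lemma homogeneous_iter_up k j v :
  homogeneous k v -> homogeneous (k + j) (iter j U v).
Proof.
by move=> hv; elim: j => [|j IH]; rewrite ?addn0 // addnS; apply: homogeneous_up.
Qed.

Lemma homogeneous_down k v X :
  homogeneous k v -> down v X != 0 -> k = (\dim X).+1.
Proof.
move=> hv; rewrite ffunE => nz; apply/eqP; apply: contraNT nz => dX.
rewrite big1 // => Y /andP[_ /eqP dY]; apply/eqP; apply: contraNT dX => /hv <-.
exact/eqP.
Qed.

Lemma homogeneous_rank_unique i j v :
  v != 0 -> homogeneous i v -> homogeneous j v -> i = j.
Proof.
move=> v0 hi hj; have [X /[dup]/hi <- /hj <- //] : exists X, v X != 0.
apply/existsP; apply: contraNT v0 => /existsPn z; apply/eqP/ffunP=> X.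
by rewrite ffunE; apply/eqP; move: (z X); rewrite negbK.
Qed.

Lemma inner_homogeneous i j v w :
  homogeneous i v -> homogeneous j w -> i != j -> inner v w = 0.
Proof.
move=> hv hw ij; rewrite /inner big1 // => X _.
have [->|/hv vX] := eqVneq (v X) 0; first exact: mul0r.
have [->|/hw wX] := eqVneq (w X) 0; first by rewrite conjC0 mulr0.
by rewrite -vX -wX eqxx in ij.
Qed.

Lemma down_up_homogeneous k v : homogeneous k v ->
  down (up v) =
    up (down v) + ((qint q (n - k))%:R - (qint q k)%:R : C) *: v.
Proof.
move=> hv; apply/ffunP=> X; rewrite down_up !ffunE.
by have [->|/hv ->] := eqVneq (v X) 0; first by rewrite mulr0 scaler0.
Qed.

(** The zero vector is primitive of every rank. *)
Definition primitive k v : Prop := homogeneous k v /\ down v = 0.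

(** The square of the singular value between ranks k + j and k + j + 1 on a
    chain that starts at rank k. *)
Definition sq_singular_value k j : nat :=
  (q ^ k * qint q j.+1 * qint q (n - k.*2 - j))%N.

Lemma down_iter_up k j v : primitive k v -> (k.*2 + j <= n)%N ->
  down (iter j.+1 U v) = (sq_singular_value k j)%:R *: iter j U v.
Proof.
case=> hv dv; elim: j => [|j IH] le.
  rewrite /= (down_up_homogeneous hv) dv linear0 add0r.
  rewrite /sq_singular_value qint1 muln1 subn0; congr (_ *: _).
  have -> : (n - k = k + (n - k.*2))%N by lia.
  by rewrite qintD natrD addrC addKr.
rewrite [iter j.+2 _ _]iterS.
rewrite (down_up_homogeneous (homogeneous_iter_up (j := j.+1) hv)).
rewrite IH; last lia.
rewrite linearZ /= -scalerDl; congr (_ *: _).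
rewrite addrA; apply/eqP; rewrite subr_eq -!natrD; apply/eqP; congr (_%:R).
have -> : (n - (k + j.+1) = n - k.*2 - j.+1 + k)%N by lia.
rewrite /sq_singular_value.
have -> : (n - k.*2 - j = (n - k.*2 - j.+1).+1)%N by lia.
exact: qint_step.
Qed.

Lemma inner_iter_up k j v w : primitive k w -> (k.*2 + j <= n)%N ->
  inner (up v) (iter j.+1 U w) =
    (sq_singular_value k j)%:R * inner v (iter j U w).
Proof.
by move=> pw le; rewrite inner_up (down_iter_up pw le) innerZr conjC_nat.
Qed.

Lemma sq_singular_value_gt0 k j :
  (k.*2 + j < n)%N -> (0 < sq_singular_value k j)%N.
Proof.
move=> lt; rewrite /sq_singular_value !muln_gt0 expn_gt0.
rewrite (ltnW (card_finNzRing_gt1 F)) /=.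
by rewrite !qint_gt0 //; lia.
Qed.

Lemma iter_up_neq0 k j v : primitive k v -> v != 0 -> (k.*2 + j <= n)%N ->
  iter j U v != 0.
Proof.
move=> pv v0; elim: j => [|j IH] le //.
rewrite -inner_eq0 [X in inner X]iterS (inner_iter_up _ pv); last lia.
rewrite mulf_neq0 // ?inner_eq0 ?IH //; try lia.
by rewrite pnatr_eq0 -?lt0n ?sq_singular_value_gt0 //; lia.
Qed.

Lemma iter_up_eq0 k v : primitive k v -> (k.*2 <= n)%N ->
  iter (n - k.*2).+1 U v = 0.
Proof.
move=> pv le; apply/eqP; rewrite -inner_eq0 [X in inner X]iterS.
rewrite (inner_iter_up _ pv); last by rewrite subnKC.
by rewrite /sq_singular_value subnn qint0 muln0 mul0r.
Qed.

(** The norms satisfy <Uv, Uv> = ([n-k]_q - [k]_q) <v, v>, and the scalar is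
    negative when n - k < k. *)
Lemma primitive_high k v : primitive k v -> (n < k.*2)%N -> v = 0.
Proof.
case=> hv dv lt; apply/eqP; rewrite -inner_eq0; apply/eqP.
have := inner_ge0 (up v).
rewrite inner_up (down_up_homogeneous hv) dv linear0 add0r innerZr.
rewrite rmorphB /= !conjC_nat => ge0.
have neg : (qint q (n - k))%:R - (qint q k)%:R < 0 :> C.
  rewrite subr_lt0 ltr_nat ltn_qint ?(ltnW (card_finNzRing_gt1 F)) //; lia.
by apply/eqP; rewrite eq_le inner_ge0 andbT -(nmulr_rge0 _ neg).
Qed.

(** Adjunction and [down_iter_up] remove one U from both sides until one of the
    exponents is 0.  If the other one is not, D meets a primitive vector; if it
    is, the two vectors either have different ranks or are covered by the last
    hypothesis. *)
Lemma inner_primitives k k' i j v w : primitive k v -> primitive k' w ->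
  (k.*2 + i <= n)%N -> (k'.*2 + j <= n)%N ->
  (k = k' -> i = j -> inner v w = 0) -> inner (iter i U v) (iter j U w) = 0.
Proof.
move=> pv pw; elim: i j => [|i IH] [|j] li lj vw.
- have [e|ne] := eqVneq k k'; first exact: vw.
  by apply: inner_homogeneous ne; [case: pv|case: pw].
- by rewrite -inner_conj [X in inner X]iterS inner_up pv.2 inner0r conjC0.
- by rewrite [X in inner X]iterS inner_up pw.2 inner0r.
rewrite [X in inner X]iterS (inner_iter_up _ pw) ?IH ?mulr0 //; try lia.
by move=> kk ij; apply: vw => //; rewrite ij.
Qed.

End UpDown.

(** * The orthogonal symmetric Jordan basis *)

Section JordanBasis.

Variables (C : numClosedFieldType) (F : finFieldType) (E : vectType F).
Local Notation q := #|F|.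
Local Notation n := (\dim {:E}).
Local Notation V := (freeVect C {vspace E}).
Local Notation U := (@up C F E).
Implicit Types (X Y Z : {vspace E}) (v w x b : V).

(** Its kernel is the space of vectors of rank k, which makes
    [primitive_space] an intersection of two kernels. *)
Definition off_rank k v : V := [ffun X => if \dim X == k then 0 else v X].

Lemma off_rank_is_linear k : linear (off_rank k).
Proof.
move=> a v w; apply/ffunP=> X; rewrite !ffunE.
by case: ifP; rewrite ?scaler0 ?addr0.
Qed.

HB.instance Definition _ k :=
  GRing.isLinear.Build C V V _ (off_rank k) (off_rank_is_linear k).

Definition primitive_space k : {vspace V} :=
  (lker (linfun (@down C F E)) :&: lker (linfun (off_rank k)))%VS.

Lemma mem_primitive_space k v : v \in primitive_space k <-> primitive k v.
Proof.
rewrite memv_cap !memv_ker !lfunE /=; split=> [/andP[/eqP dv /eqP rv]|[hv dv]].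
  split=> // X nz; apply/eqP; apply: contraNT nz => dX.
  by move/ffunP/(_ X): rv; rewrite !ffunE (negbTE dX) => ->.
rewrite dv eqxx; apply/eqP/ffunP=> X; rewrite !ffunE; case: eqP => // dX.
by apply/eqP; apply: contra_notT dX => /hv.
Qed.

Definition primitive_basis k : seq V := gram_schmidt (vbasis (primitive_space k)).

Definition chain_starts : seq (nat * V) :=
  [seq (k, b) | k <- iota 0 n./2.+1, b <- primitive_basis k].

Definition chain_of (p : nat * V) : seq V :=
  [seq iter j U p.2 | j <- iota 0 (n - p.1.*2).+1].

Definition jordan_basis : seq V := flatten (map chain_of chain_starts).

Lemma mem_chain_starts k b :
  (k, b) \in chain_starts = (k.*2 <= n)%N && (b \in primitive_basis k).
Proof.
apply/allpairsPdep/andP=> [[k' [b' [+ b'B [-> ->]]]]|[le bB]].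
  by rewrite mem_iota => ?; split=> //; lia.
by exists k, b; split=> //; rewrite mem_iota; lia.
Qed.

Lemma chain_starts_primitive k b : (k, b) \in chain_starts -> primitive k b.
Proof.
rewrite mem_chain_starts => /andP[_ bB]; apply/mem_primitive_space.
by have := memv_span bB; rewrite span_gram_schmidt (span_basis (vbasisP _)).
Qed.

Lemma chain_starts_neq0 k b : (k, b) \in chain_starts -> b != 0.
Proof.
rewrite mem_chain_starts => /andP[_]; apply: contraTneq => ->.
by have [] := gram_schmidt_orthogonal (vbasis (primitive_space k)).
Qed.

Lemma jordan_basisP v :
  reflect (exists k b j,
             [/\ (k, b) \in chain_starts, (k.*2 + j <= n)%N & v = iter j U b])
          (v \in jordan_basis).
Proof.
apply: (iffP allpairsPdep) => [[[k b] [j [bs + ->]]]|[k [b [j [bs le ->]]]]].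
  rewrite mem_iota /= => lt; exists k, b, j; split=> //.
  by move: bs; rewrite mem_chain_starts => /andP[]; lia.
by exists (k, b), j; split=> //; rewrite mem_iota /=; lia.
Qed.

Lemma chain_starts_orthogonal k k' i j b b' :
  (k, b) \in chain_starts -> (k', b') \in chain_starts ->
  (k.*2 + i <= n)%N -> (k'.*2 + j <= n)%N ->
  (k, b, i) != (k', b', j) -> inner (iter i U b) (iter j U b') = 0.
Proof.
move=> bs bs' le le' ne; apply: inner_primitives le le' _;
  try exact: chain_starts_primitive.
move=> kk ij; rewrite -{}kk -{}ij in bs' ne.
move: bs bs'; rewrite !mem_chain_starts => /andP[_ bB] /andP[_ bB'].
have [_ _ oB] := gram_schmidt_orthogonal (vbasis (primitive_space k)).
by apply: oB => //; apply: contraNneq ne => ->.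
Qed.

(** Distinct indices (k, b, j) give orthogonal vectors; as these are nonzero, the
    vectors of distinct indices are also distinct, which gives uniqueness. *)
Lemma jordan_basis_orthogonal : orthogonal_family jordan_basis.
Proof.
have nz k b j : (k, b) \in chain_starts -> (k.*2 + j <= n)%N -> iter j U b != 0.
  by move=> bs; apply: iter_up_neq0; [exact: chain_starts_primitive
    |exact: chain_starts_neq0 bs].
split.
- apply: allpairs_uniq_dep => [|p _|x y]; last 1 first.
  + move=> /allpairsPdep[[k b] [i [bs li ->]]].
    move=> /allpairsPdep[[k' b'] [j [bs' lj ->]]] /= e.
    move: li lj (bs) (bs'); rewrite !mem_iota !mem_chain_starts /=.
    move=> li lj /andP[le _] /andP[le' _].
    have {}li : (k.*2 + i <= n)%N by lia.
    have {}lj : (k'.*2 + j <= n)%N by lia.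
    suff /eqP[-> -> ->] : (k, b, i) == (k', b', j) by [].
    apply: contraTT (nz _ _ _ bs li) => ne; rewrite negbK -inner_eq0.
    by rewrite [X in inner _ X]e (chain_starts_orthogonal bs bs' li lj ne).
  + apply: allpairs_uniq_dep => [|k _|x y]; first exact: iota_uniq.
      by have [] := gram_schmidt_orthogonal (vbasis (primitive_space k)).
    move=> /allpairsPdep[k [b [_ _ ->]]] /allpairsPdep[k' [b' [_ _ ->]]] /=.
    by case=> -> ->.
  + exact: iota_uniq.
- apply/negP=> /jordan_basisP[k [b [j [bs le /esym/eqP]]]].
  by rewrite (negbTE (nz _ _ _ bs le)).
- move=> v w /jordan_basisP[k [b [i [bs le ->]]]].
  move=> /jordan_basisP[k' [b' [j [bs' le' ->]]]] ne.
  apply: (chain_starts_orthogonal bs bs' le le').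
  by apply: contra_neq ne => -[_ -> ->].
Qed.

Lemma jordan_basis_up v : v \in jordan_basis ->
  (up v \in jordan_basis) \/ up v = 0.
Proof.
case/jordan_basisP=> k [b [j [bs le ->]]].
have [lt|ge] := ltnP (k.*2 + j) n.
  by left; apply/jordan_basisP; exists k, b, j.+1; split=> //; lia.
right; have -> : j = (n - k.*2)%N by lia.
by rewrite -[LHS]iterS iter_up_eq0 //; [exact: chain_starts_primitive|lia].
Qed.

(** A primitive vector v of rank k <= n/2 is a combination of elements of J, so
    orthogonality to J yields <v, v> = 0. *)
Lemma primitive_orthogonal_eq0 k v : primitive k v ->
  {in jordan_basis, forall b, inner v b = 0} -> v = 0.
Proof.
move=> pv vJ; have [le|lt] := leqP k.*2 n; last exact: primitive_high pv lt.
apply/eqP; rewrite -inner_eq0; apply/eqP.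
apply: (inner_span (B := primitive_basis k)) => [b bB|].
  apply: vJ; apply/jordan_basisP; exists k, b, 0%N.
  by rewrite mem_chain_starts addn0; split=> //; rewrite le.
rewrite span_gram_schmidt (span_basis (vbasisP _)).
exact/mem_primitive_space.
Qed.

(** Induction on the rank: <D v, b> = <v, U b> and U b is 0 or again in J, so D v
    is orthogonal to J too, has smaller rank, and hence is 0. *)
Lemma orthogonal_jordan_basis_eq0 k v : homogeneous k v ->
  {in jordan_basis, forall b, inner v b = 0} -> v = 0.
Proof.
elim: k v => [|k IH] v hv vJ; apply: (primitive_orthogonal_eq0 (conj hv _) vJ).
  apply/ffunP=> X; rewrite [RHS]ffunE; apply/eqP.
  by case: eqP => // /eqP /(homogeneous_down hv).
apply: IH => [X nz|b bJ]; first by have [] := homogeneous_down hv nz.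
rewrite -inner_conj -inner_up inner_conj.
by have [/vJ|->] := jordan_basis_up bJ; rewrite ?inner0r.
Qed.

Lemma homogeneous_single X : homogeneous (\dim X) (single C X).
Proof. by move=> Y; rewrite ffunE pnatr_eq0 eqb0 negbK => /eqP ->. Qed.

(** The elements of J of a rank other than k are orthogonal to v and do not
    contribute to the projection. *)
Lemma homogeneous_residual k v : homogeneous k v ->
  homogeneous k (residual jordan_basis v).
Proof.
move=> hv X; apply: contra_neq_eq => dX.
rewrite !ffunE sum_ffunE big_seq big1 ?subr0.
  by apply/eqP; apply: contraNT dX => /hv ->.
move=> b /jordan_basisP[i [c [j [cs _ ->]]]].
have hb := homogeneous_iter_up (j := j) (chain_starts_primitive cs).1.
have [e|ne] := eqVneq k (i + j)%N.
  rewrite ffunE; suff -> : iter j U c X = 0 by rewrite scaler0.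
  by apply/eqP; apply: contraNT dX => /hb ->; rewrite e.
by rewrite (inner_homogeneous hv hb ne) mul0r scale0r ffunE.
Qed.

Lemma jordan_basis_of : basis_of {:V} jordan_basis.
Proof.
rewrite /basis_of orthogonal_family_free ?andbT;
  last exact: jordan_basis_orthogonal.
rewrite eqEsubv subvf /=; apply/subvP=> v _.
have -> : v = \sum_X (v X : C) *: single C X.
  apply/ffunP=> Y; rewrite sum_ffunE (bigD1 Y) //= big1 ?addr0.
    by rewrite !ffunE eqxx; apply/esym/mulr1.
  by move=> X XY; rewrite !ffunE eq_sym (negbTE XY); apply: mulr0.
apply: rpred_sum => X _; apply: rpredZ.
rewrite -[single C X]subr0.
have hr := homogeneous_residual (homogeneous_single (X := X)).
rewrite -(orthogonal_jordan_basis_eq0 hr).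
  exact: mem_span_residual.
exact/residual_orthogonal/jordan_basis_orthogonal.
Qed.

Lemma nth_chain_of k b j : (k.*2 + j <= n)%N ->
  (chain_of (k, b))`_j = iter j U b.
Proof.
by move=> le; rewrite (nth_map 0%N) ?size_iota ?nth_iota //=; lia.
Qed.

Lemma chain_of_chain k b : (k, b) \in chain_starts ->
  sym_jordan_chain k (chain_of (k, b)).
Proof.
move=> bs; have pb := chain_starts_primitive bs.
have le : (k.*2 <= n)%N by move: bs; rewrite mem_chain_starts => /andP[].
split=> //.
- by rewrite size_map size_iota.
- move=> i ki; have le' : (k.*2 + (i - k) <= n)%N by lia.
  rewrite nth_chain_of //; split.
    exact: (iter_up_neq0 pb (chain_starts_neq0 bs) le').
  have {1}-> : i = (k + (i - k))%N by lia.
  exact: homogeneous_iter_up pb.1.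
- move=> i ki; rewrite !nth_chain_of; try lia.
  by have -> : (i - k = (i.-1 - k).+1)%N by lia.
- rewrite nth_chain_of -?iterS; last lia.
  have -> : (n - k - k = n - k.*2)%N by lia.
  exact: iter_up_eq0 pb le.
Qed.

Lemma jordan_basis_sym : sym_jordan_basis jordan_basis.
Proof.
split; first exact: jordan_basis_of.
exists (map chain_of chain_starts); last exact: perm_refl.
by move=> _ /mapP[[k b] bs ->]; exists k; apply: chain_of_chain.
Qed.

Lemma sym_jordan_chain_iter k s i : sym_jordan_chain k s -> (i <= n - k.*2)%N ->
  s`_i = iter i U s`_0.
Proof.
case=> le _ _ step _; elim: i => // i IH lt.
rewrite iterS -IH; last lia.
have := step (k + i.+1)%N; rewrite addKn => <-; last lia.
by congr (up s`_ _); lia.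
Qed.

(** If the first vector were U^j b with b primitive of rank k - j and j > 0, the
    chain of b would end at rank n - k + j, so U would not kill the vector
    of rank n - k. *)
Lemma sym_jordan_chain_start k s : sym_jordan_chain k s ->
  s`_0 \in jordan_basis -> primitive k s`_0.
Proof.
move=> ch /jordan_basisP[i [b [j [bs le e]]]].
have pb := chain_starts_primitive bs.
have [le2 _ nzh _ last0] := ch.
have range : (k <= k <= n - k)%N by lia.
have [nz hom] := nzh k range.
rewrite subnn e in nz hom.
have kij := homogeneous_rank_unique nz hom (homogeneous_iter_up (j := j) pb.1).
move: last0; rewrite (sym_jordan_chain_iter ch); last lia.
rewrite e -iterS -iterD; case: (posnP j) => [j0|j_gt0].
  by move: kij; rewrite j0 addn0 => ->.
move/eqP; rewrite (negbTE (iter_up_neq0 pb (chain_starts_neq0 bs) _)) //; lia.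
Qed.

Lemma vnorm_iter_up k j v : primitive k v -> v != 0 -> (k.*2 + j < n)%N ->
  vnorm (iter j.+1 U v) / vnorm (iter j U v) = sqrtC (sq_singular_value E k j)%:R.
Proof.
move=> pv v0 lt; rewrite /vnorm [X in inner X]iterS.
rewrite (inner_iter_up _ pv); last lia.
rewrite rootCMl ?ler0n // mulfK // rootC_eq0 // inner_eq0.
by apply: iter_up_neq0 pv v0 _; lia.
Qed.

End JordanBasis.

Theorem theorem2p1 (R : realType) (q n : nat) (F : finFieldType)
    (E : vectType F) (hq : #|F| = q) (hn : \dim {:E} = n) :
  exists J : seq (freeVect R[i] {vspace E}),
    [/\ sym_jordan_basis J,
        forall v w, v \in J -> w \in J -> v != w -> inner v w = 0
      & forall (k : nat) (s : seq (freeVect R[i] {vspace E})),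
          (k.*2 <= n)%N -> sym_jordan_chain k s -> {subset s <= J} ->
          forall u : nat, (k <= u < n - k)%N ->
            vnorm s`_(u.+1 - k) / vnorm s`_(u - k) =
            sqrtC ((q ^ k * qint q (u + 1 - k) * qint q (n - k - u))%:R : R[i])].
Proof.
subst q n; exists (jordan_basis R[i] E); split.
- exact: jordan_basis_sym.
- by case: (jordan_basis_orthogonal R[i] E).
move=> k s le ch sJ u ku.
have size_s : size s = (\dim {:E} - k.*2).+1 by case: ch.
have ps : primitive k s`_0.
  by apply: (sym_jordan_chain_start ch); apply/sJ/mem_nth; rewrite size_s.
have nz : s`_0 != 0.
  by case: ch => _ _ /(_ k) + _ _; rewrite subnn => -[] //; lia.
have -> : (u.+1 - k = (u - k).+1)%N by lia.
rewrite (sym_jordan_chain_iter ch (i := (u - k).+1)); last lia.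
rewrite (sym_jordan_chain_iter ch (i := u - k)); last lia.
rewrite (vnorm_iter_up ps nz); last lia.
by rewrite /sq_singular_value; congr (sqrtC (_ * qint _ _ * qint _ _)%:R); lia.
Qed.
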